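(* Consider the single-segment ($m=1$) total-energy platooning problem with arbitrary $n$ in which all vehicles have the same allowable energy usage, $A_j=C_j(S_{j1}-\beta_j)=A$ for all $j$: minimize $\sum_{j=1}^n D_1\delta_j(1-\eta_{[j]})$ over permutations $([1],\ldots,[n])$ of $(1,\ldots,n)$ subject to $D_1\delta_j(1-\eta_{[j]})\le A$ for all $j$. Rule 2 solves this problem in $O(n\log n)$ time, by either showing the infeasibility of the problem or finding an optimal solution if one exists.
   Context: Setting. There are $n$ vehicles and one road segment of length $D_1>0$. Vehicle $j$ has battery capacity $C_j>0$, usage rate $\delta_j>0$, initial state of charge $S_{j1}\in[0,1]$, and minimum allowable state of charge $\beta_j$ with $0\le\beta_j<S_{j1}$. Platoon positions have usage-rate reductions $0\le\eta_1\le\cdots\le\eta_n<1$. In a solution, $[j]$ is the position of vehicle $j$, its energy usage is $D_1\delta_j(1-\eta_{[j]})$, and its final state of charge is $S_{j1}-D_1\delta_j(1-\eta_{[j]})/C_j$. A solution is feasible if each final state of charge is at least $\beta_j$, equivalently if the energy usage of each vehicle $j$ is at most $A_j=C_j(S_{j1}-\beta_j)$; the problem is infeasible if there is no feasible solution. Rule 2: Reindex the vehicles in non-decreasing order of $\delta_j$ and assign vehicle $j$ to the $j$th position, for $j=1,\ldots,n$. (If the resulting assignment is not feasible, infeasibility is reported.) Running time counts elementary arithmetic operations and comparisons. *)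

(* Defs.v *)
From mathcomp Require Import all_boot all_order all_algebra all_fingroup.
From mathcomp Require Import all_classical all_reals all_analysis.

Set Implicit Arguments.
Unset Strict Implicit.
Unset Printing Implicit Defensive.

Import Order.TTheory GRing.Theory Num.Theory.

Local Open Scope ring_scope.

(* Vehicles and platoon positions are both indexed by 'I_n, from 0.  The data
   live in an arbitrary type V so that the algorithm below can be written
   without access to the structure of the real numbers. *)
Record instance (V : Type) (n : nat) := Instance {
  segment : V;            (* length D_1 of the road segment *)
  capacity : 'I_n -> V;   (* C_j *)
  rate : 'I_n -> V;       (* delta_j *)
  charge : 'I_n -> V;     (* S_j1 *)
  charge_min : 'I_n -> V; (* beta_j *)
  reduction : 'I_n -> V   (* eta_k, indexed by position *)
}.

(* A solution is a permutation s, the position [j] of vehicle j being s j. *)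

Definition valid (R : realType) (n : nat) (I : instance R n) : Prop :=
  [/\ 0 < segment I,
      forall j, 0 < capacity I j /\ 0 < rate I j,
      forall j, 0 <= charge I j <= 1,
      forall j, 0 <= charge_min I j < charge I j
    & (forall k, 0 <= reduction I k < 1) /\
      (forall k l : 'I_n, (k <= l)%N -> reduction I k <= reduction I l)].

Definition usage (R : realType) (n : nat) (I : instance R n) (s : 'S_n)
    (j : 'I_n) : R :=
  segment I * rate I j * (1 - reduction I (s j)).

Definition allowable (R : realType) (n : nat) (I : instance R n)
    (j : 'I_n) : R :=
  capacity I j * (charge I j - charge_min I j).

Definition final_charge (R : realType) (n : nat) (I : instance R n) (s : 'S_n)
    (j : 'I_n) : R :=
  charge I j - usage I s j / capacity I j.

Definition feasible (R : realType) (n : nat) (I : instance R n) (s : 'S_n)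
    : Prop :=
  forall j, usage I s j <= allowable I j.

Lemma feasibleE (R : realType) (n : nat) (I : instance R n) (s : 'S_n) :
  valid I -> feasible I s <-> (forall j, charge_min I j <= final_charge I s j).
Proof.
case=> _ C0 _ _ _; split=> H j; move: (H j); have [Cj _] := C0 j;
by rewrite /final_charge /allowable lerBrDl -lerBrDr ler_pdivrMr // mulrC.
Qed.

Definition infeasible (R : realType) (n : nat) (I : instance R n) : Prop :=
  ~ exists s : 'S_n, feasible I s.

Definition total_usage (R : realType) (n : nat) (I : instance R n)
    (s : 'S_n) : R :=
  \sum_j usage I s j.

Definition optimal (R : realType) (n : nat) (I : instance R n) (s : 'S_n)
    : Prop :=
  feasible I s /\
  forall t : 'S_n, feasible I t -> total_usage I s <= total_usage I t.

(* [p k] is the vehicle that receives the new index k; ties in the rates may be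
   broken arbitrarily, so several assignments s may satisfy this predicate. *)
Definition rule2 (R : realType) (n : nat) (I : instance R n) (s : 'S_n)
    : Prop :=
  exists p : 'S_n,
    (forall k l : 'I_n, (k <= l)%N -> rate I (p k) <= rate I (p l)) /\
    (forall k, s (p k) = k).

(* Computation trees over numbers of type V.  A definition that is polymorphic
   in V, such as [rule2_prog] below, can combine and compare numbers only by the
   steps [One], [Arith] and [Leq], which are the ones that [cost] counts; moving
   numbers and vehicle labels around in memory is free. *)
Inductive arith := Add | Sub | Mul | Div.

Inductive prog (V A : Type) : Type :=
  | Ret of A
  | One of (V -> prog V A)
  | Arith of arith & V & V & (V -> prog V A)
  | Leq of V & V & (bool -> prog V A).

Arguments Ret {V A}.
Arguments One {V A}.

Fixpoint bind (V A B : Type) (m : prog V A) (f : A -> prog V B) : prog V B :=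
  match m with
  | Ret a => f a
  | One k => One (fun v => bind (k v) f)
  | Arith o x y k => Arith o x y (fun v => bind (k v) f)
  | Leq x y k => Leq x y (fun b => bind (k b) f)
  end.

Notation "'let*' x := m 'in' f" := (bind m (fun x => f))
  (at level 200, x name, m at level 100, f at level 200).

Definition one (V : Type) : prog V V := One Ret.
Definition arithm (V : Type) (o : arith) (x y : V) : prog V V :=
  Arith o x y Ret.
Definition leqm (V : Type) (x y : V) : prog V bool := Leq x y Ret.

Definition eval_arith (R : realType) (o : arith) (x y : R) : R :=
  match o with
  | Add => x + y
  | Sub => x - y
  | Mul => x * y
  | Div => x / y
  end.

Fixpoint result (R : realType) (A : Type) (m : prog R A) : A :=
  match m with
  | Ret a => a
  | One k => result (k 1)
  | Arith o x y k => result (k (eval_arith o x y))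
  | Leq x y k => result (k (x <= y))
  end.

(* Running time: each arithmetic operation and each comparison costs 1, and so
   does loading the constant 1. *)
Fixpoint cost (R : realType) (A : Type) (m : prog R A) : nat :=
  match m with
  | Ret _ => 0
  | One k => (cost (k 1)).+1
  | Arith o x y k => (cost (k (eval_arith o x y))).+1
  | Leq x y k => (cost (k (x <= y))).+1
  end.

(* Bottom-up merge sort, following [path.sort] with an effectful comparison. *)
Section MergeSort.
Context (V T : Type) (le : T -> T -> prog V bool).

Fixpoint mergem (s1 : seq T) : seq T -> prog V (seq T) :=
  if s1 is x1 :: s1' then
    fix mergem_s1 (s2 : seq T) : prog V (seq T) :=
      if s2 is x2 :: s2' then
        let* b := le x1 x2 in
        if b then let* s := mergem s1' s2 in Ret (x1 :: s)
        else let* s := mergem_s1 s2' in Ret (x2 :: s)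
      else Ret s1
  else fun s2 => Ret s2.

Fixpoint pushm (s1 : seq T) (ss : seq (seq T)) : prog V (seq (seq T)) :=
  match ss with
  | [::] :: ss' | [::] as ss' => Ret (s1 :: ss')
  | s2 :: ss' =>
      let* s := mergem s2 s1 in
      let* ss'' := pushm s ss' in
      Ret ([::] :: ss'')
  end.

Fixpoint popm (s1 : seq T) (ss : seq (seq T)) : prog V (seq T) :=
  if ss is s2 :: ss' then let* s := mergem s2 s1 in popm s ss' else Ret s1.

Fixpoint sortm_rec (ss : seq (seq T)) (s : seq T) : prog V (seq T) :=
  if s is [:: x1, x2 & s'] then
    let* b := le x1 x2 in
    let* ss' := pushm (if b then [:: x1; x2] else [:: x2; x1]) ss in
    sortm_rec ss' s'
  else popm s ss.

Definition sortm : seq T -> prog V (seq T) := sortm_rec [::].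

End MergeSort.

(* Does vehicle j, placed in position k, respect its allowable usage? *)
Definition check_vehicle (V : Type) (n : nat) (I : instance V n)
    (j k : 'I_n) : prog V bool :=
  let* d := arithm Mul (segment I) (rate I j) in
  let* o := one V in
  let* r := arithm Sub o (reduction I k) in
  let* u := arithm Mul d r in
  let* c := arithm Sub (charge I j) (charge_min I j) in
  let* a := arithm Mul (capacity I j) c in
  leqm u a.

Fixpoint check_all (V : Type) (n : nat) (I : instance V n)
    (jks : seq ('I_n * 'I_n)) : prog V bool :=
  if jks is jk :: jks' then
    let* b := check_vehicle I jk.1 jk.2 in
    if b then check_all I jks' else Ret false
  else Ret true.

(* Rule 2 as an algorithm: [Some js] lists the vehicles in the order of their
   positions, [None] reports infeasibility. *)
Definition rule2_prog (V : Type) (n : nat) (I : instance V n)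
    : prog V (option (seq 'I_n)) :=
  let* js := sortm (fun i j => leqm (rate I i) (rate I j)) (enum 'I_n) in
  let* b := check_all I (zip js (enum 'I_n)) in
  Ret (if b then Some js else None).

Definition by_position (n : nat) (s : 'S_n) : seq 'I_n :=
  [seq (s^-1)%g k | k <- enum 'I_n].

(* Main.v *)
(* Optimality is the rearrangement inequality, proved by swaps that fix the
   positions from the last one down.  For feasibility, among the vehicles that
   Rule 2 puts in position k or later, all with a rate at least that of the
   vehicle in position k, any other solution places one in position k or
   earlier.  That vehicle then uses at least as much energy as the one that Rule
   2 puts in position k, and the allowances are equal.

   For the running time, a nonempty list at level k of the merge sort stack
   has at least 2 ^ k elements, so the stack has height at most log2 n, and each
   element pays for one comparison whenever a merge moves it one level up. *)

Require Import Defs.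
From mathcomp Require Import all_boot all_order all_algebra all_fingroup.
From mathcomp Require Import all_classical all_reals all_analysis.
From mathcomp Require Import zify ring lra.

Set Implicit Arguments.
Unset Strict Implicit.
Unset Printing Implicit Defensive.

Import Order.TTheory GRing.Theory Num.Theory.

Local Open Scope classical_set_scope.
Local Open Scope ring_scope.

(** * Optimality and feasibility of the sorted assignment *)

Lemma sum_rearrange (R : realDomainType) (n : nat) (x y : 'I_n -> R)
    (s : 'S_n) :
  (forall k l : 'I_n, (k <= l)%N -> x k <= x l) ->
  (forall k l : 'I_n, (k <= l)%N -> y k <= y l) ->
  \sum_k x k * y (s k) <= \sum_k x k * y k.
Proof.
move=> x_le y_le.
(* Induction on [m]; for [m = n] the condition on [t] is vacuous. *)
suff sorted_from m (t : 'S_n) : (forall k : 'I_n, (m <= k)%N -> t k = k) ->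
    \sum_k x k * y (t k) <= \sum_k x k * y k.
  by apply: (sorted_from n) => k; rewrite leqNgt ltn_ord.
elim: m t => [|m IHm] t fix_t.
  by apply: ler_sum => k _; rewrite fix_t.
have [n_le_m|m_lt_n] := leqP n m.
  apply: IHm => k; have := ltn_ord k; lia.
pose a := Ordinal m_lt_n; pose b := (t^-1)%g a.
have tb : t b = a by rewrite permKV.
have [b_a|b_neq_a] := eqVneq b a.
  apply: IHm => k; rewrite leq_eqVlt => /orP[/eqP m_k|/fix_t//].
  by have -> : k = a; [exact: val_inj | rewrite -{1}b_a tb].
have le_am (c : 'I_n) : (c <= a)%N || (t c == c).
  by have [//|/fix_t ->] := leqP c a; rewrite eqxx.
have b_le_a : (b <= a)%N.
  by have := le_am b; rewrite tb [a == b]eq_sym (negPf b_neq_a) orbF.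
have ta_le_a : (t a <= a)%N.
  by have := le_am (t a); rewrite (inj_eq perm_inj) => /orP[//|/eqP ->].
(* Composing with [tperm a (t a)] fixes [a] and sends [b] to [t a]. The sum grows by
   [(x a - x b) * (y a - y (t a))], nonnegative since [b] and [t a] are at most [a]. *)
apply: le_trans (IHm (t * tperm a (t a))%g _); last first.
  move=> k; rewrite leq_eqVlt permM => /orP[/eqP m_k|m_lt_k].
    by have -> : k = a; [exact: val_inj | rewrite tpermR].
  rewrite (fix_t k) // tpermD //; apply/eqP => k_eq; move: m_lt_k.
    by rewrite -k_eq ltnn.
  by move: ta_le_a; rewrite -k_eq /=; lia.
rewrite [leLHS](bigD1 a) //= [leRHS](bigD1 a) //=.
rewrite [X in _ + X <= _](bigD1 b) //= [X in _ <= _ + X](bigD1 b) //=.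
rewrite !permM tb tpermL tpermR !addrA.
apply: lerD; last first.
  apply: ler_sum => k /andP[k_neq_a k_neq_b]; rewrite permM tpermD //.
    by rewrite -tb (inj_eq perm_inj) eq_sym.
  by rewrite (inj_eq perm_inj) eq_sym.
have xab : 0 <= x a - x b by rewrite subr_ge0 x_le.
have yab : 0 <= y a - y (t a) by rewrite subr_ge0 y_le.
by have := mulr_ge0 xab yab; lra.
Qed.

(** Pigeonhole: otherwise [s] would inject the indices from [k] on into those beyond [k], which are
    one fewer. *)
Lemma perm_crosses_down (n : nat) (s : 'S_n) (k : 'I_n) :
  exists2 l : 'I_n, (k <= l)%N & (s l <= k)%N.
Proof.
have [/existsP[l /andP[]]|] :=
  boolP [exists l : 'I_n, (k <= l)%N && (s l <= k)%N]; first by exists l.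
rewrite negb_exists => /forallP no_l.
pose B := [set l : 'I_n | (k <= l)%N]%SET.
have /subset_leq_card : (s @: B \subset B :\ k)%SET.
  apply/fintype.subsetP => _ /imsetP[l l_B ->]; move: (no_l l) l_B.
  rewrite !inE -val_eqE /=; lia.
have B_gt : (#|(B :\ k)%SET| < #|B|)%N.
  by rewrite [ltnRHS](cardsD1 k B) inE leqnn.
by rewrite (card_imset _ perm_inj) => /leq_ltn_trans/(_ B_gt); rewrite ltnn.
Qed.

Lemma rule2_optimal (R : realType) (n : nat) (I : instance R n) (s : 'S_n) :
  valid I -> rule2 I s -> feasible I s -> optimal I s.
Proof.
case=> D_gt0 _ _ _ [_ eta_le] [p [p_sorted sp]] s_feas; split=> // t _.
(* Minimizing the usage thus means maximizing a sum of rates times reductions, and [p * s] is the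
   identity. *)
have usageE u : total_usage I u = segment I *
    (\sum_j rate I j - \sum_k rate I (p k) * reduction I ((p * u)%g k)).
  rewrite /total_usage (reindex_inj (@perm_inj _ p)).
  rewrite [in RHS](reindex_inj (@perm_inj _ p)).
  rewrite -sumrB mulr_sumr; apply: eq_bigr => k _; rewrite /usage permM; ring.
rewrite !usageE ler_pM2l // lerD2l lerN2.
under [leRHS]eq_bigr do rewrite permM sp.
exact: sum_rearrange.
Qed.

Lemma rule2_feasible (R : realType) (n : nat) (I : instance R n) (A : R)
    (s t : 'S_n) :
  valid I -> (forall j, allowable I j = A) -> rule2 I s ->
  feasible I t -> feasible I s.
Proof.
case=> D_gt0 pos _ _ [eta01 eta_le] allowA [p [p_sorted sp]] t_feas j.
rewrite -(permKV p j); set k := (p^-1)%g j.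
have [l k_le_l tl_le_k] := perm_crosses_down (p * t)%g k.
rewrite permM in tl_le_k.
rewrite allowA -(allowA (p l)); apply: le_trans (t_feas (p l)).
rewrite /usage sp -!mulrA ler_pM2l //; apply: ler_pM.
- by have [_ /ltW] := pos (p k).
- by have /andP[_ /ltW] := eta01 k; rewrite subr_ge0.
- exact: p_sorted.
- by rewrite lerD2l lerN2 eta_le.
Qed.

(** * Correctness and amortized cost of merge sort *)

Lemma result_bind (R : realType) (A B : Type) (m : prog R A)
    (f : A -> prog R B) :
  result (bind m f) = result (f (result m)).
Proof. by elim: m => //=. Qed.

Lemma cost_bind (R : realType) (A B : Type) (m : prog R A)
    (f : A -> prog R B) :
  cost (bind m f) = (cost m + cost (f (result m)))%N.
Proof. by elim: m => //= *; rewrite addSn; congr _.+1. Qed.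

Section MergeSort.
Context (R : realType) (T : Type) (le : T -> T -> prog R bool).

Let leT x y := result (le x y).

Lemma result_mergem s1 s2 : result (mergem le s1 s2) = merge leT s1 s2.
Proof.
elim: s1 s2 => [|x1 s1 IH1] //; elim=> [|x2 s2 IH2] //.
rewrite /= result_bind -/(leT x1 x2); case: (leT x1 x2).
  by rewrite result_bind IH1.
by rewrite result_bind; congr cons; exact: IH2.
Qed.

Lemma result_pushm s1 ss : result (pushm le s1 ss) = merge_sort_push leT s1 ss.
Proof.
elim: ss s1 => [|[|x2 s2] ss IH] s1 //.
by rewrite /pushm -/pushm !result_bind result_mergem IH.
Qed.

Lemma result_popm s1 ss : result (popm le s1 ss) = merge_sort_pop leT s1 ss.
Proof.
by elim: ss s1 => [|s2 ss IH] s1 //; rewrite /= result_bind result_mergem IH.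
Qed.

Lemma result_sortm s : result (sortm le s) = sort leT s.
Proof.
(* The bound [m] on the size drives the induction, as the recursion removes two elements at a
   time. *)
rewrite /sortm /sort; move: [::] {2}(size s) (leqnn (size s)) => ss m.
elim: m ss s => [|m IHm] ss [|x1 [|x2 s]] //= lt_m; rewrite ?result_popm //.
rewrite !result_bind result_pushm -/(leT x1 x2).
by rewrite IHm //; lia.
Qed.

Context (le_cost : forall x y, (cost (le x y) <= 1)%N).

Lemma cost_mergem s1 s2 : (cost (mergem le s1 s2) <= size s1 + size s2)%N.
Proof.
elim: s1 s2 => [|x1 s1 IH1] //; elim=> [|x2 s2 IH2] //.
rewrite /= cost_bind; have := le_cost x1 x2; case: (result _).
  by rewrite cost_bind; have /= := IH1 (x2 :: s2); lia.
by rewrite cost_bind; move: IH2 => /=; lia.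
Qed.

(* The potential of the amortized analysis: a stack whose bottom list is at
   level k has paid for at most this many comparisons. *)
Fixpoint merge_levels (k : nat) (ss : seq (seq T)) : nat :=
  if ss is s :: ss' then k * size s + merge_levels k.+1 ss' else 0%N.

(** An empty slot may not come last, so that the last list is nonempty and its size bounds the
    height. *)
Fixpoint proper_stack (k : nat) (ss : seq (seq T)) : bool :=
  if ss is s :: ss' then
    (if s is [::] then 0 < size ss' else 2 ^ k <= size s)%N &&
    proper_stack k.+1 ss'
  else true.

Lemma sumn_shape_push s1 ss :
  sumn (shape (merge_sort_push leT s1 ss)) = (size s1 + sumn (shape ss))%N.
Proof.
elim: ss s1 => [|[|x2 s2] ss IH] s1 //.
by rewrite /merge_sort_push -/merge_sort_push /= IH size_merge size_cat /=; lia.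
Qed.

(** As in a binary counter, a carry merges two lists of at least [2 ^ k] elements into one fit for
    level [k.+1]. *)
Lemma proper_stack_push k s1 ss : (2 ^ k <= size s1)%N ->
  proper_stack k ss -> proper_stack k (merge_sort_push leT s1 ss).
Proof.
elim: ss k s1 => [|[|x2 s2] ss IH] k s1 s1_ge.
- case: s1 s1_ge => [|x1 s1] /=; last by rewrite andbT.
  by rewrite leqNgt expn_gt0.
- case: s1 s1_ge => [|x1 s1] /=; first by rewrite leqNgt expn_gt0.
  by move=> -> /andP[].
move=> /= /andP[s2_ge ss_ok]; apply/andP; split.
  by case: (ss) => [|[]].
apply: IH => //.
by rewrite size_merge size_cat /= expnS; lia.
Qed.

(** The last list alone is this large: it is nonempty and sits at level [k + size ss]. *)
Lemma proper_stack_size k ss : proper_stack k.+1 ss -> (0 < size ss)%N ->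
  (2 ^ (k + size ss) <= sumn (shape ss))%N.
Proof.
elim: ss k => [|s ss IH] k //= /andP[s_ok ss_ok] _.
have {}IH := IH k.+1 ss_ok; rewrite addSnnS in IH.
have [ss0|ss_gt0] := posnP (size ss); last by have := IH ss_gt0; lia.
by move: s_ok; rewrite ss0 addn1; case: s => [|x s] //=; lia.
Qed.

Lemma merge_levels_le k ss :
  (merge_levels k.+1 ss <= (k + size ss) * sumn (shape ss))%N.
Proof. by elim: ss k => [|s ss IH] k //=; have := IH k.+1; nia. Qed.

(** A merge at level [k] lifts both lists one level, so the potential rises by their total size,
    which bounds the comparisons made. *)
Lemma cost_pushm k s1 ss :
  (cost (pushm le s1 ss) + k * size s1 + merge_levels k ss <=
   merge_levels k (merge_sort_push leT s1 ss))%N.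
Proof.
elim: ss k s1 => [|[|x2 s2] ss IH] k s1.
- by rewrite /=; lia.
- by rewrite /=; lia.
rewrite /pushm -/pushm !cost_bind result_mergem.
rewrite -[merge_sort_push leT s1 _]/([::] ::
  merge_sort_push leT (merge leT (x2 :: s2) s1) ss).
have := cost_mergem (x2 :: s2) s1; set c1 := cost _; clearbody c1.
have := IH k.+1 (merge leT (x2 :: s2) s1); rewrite size_merge size_cat.
set s := merge _ _ _; set c2 := cost _; clearbody c2.
rewrite /= muln0; nia.
Qed.

(** There are [size ss] merges, each costing at most the total number of elements. *)
Lemma cost_popm s1 ss :
  (cost (popm le s1 ss) <= size ss * (size s1 + sumn (shape ss)))%N.
Proof.
elim: ss s1 => [|s2 ss IH] s1 //=; rewrite cost_bind result_mergem.
have := IH (merge leT s2 s1); rewrite size_merge size_cat.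
have := cost_mergem s2 s1; nia.
Qed.

Lemma cost_sortm s :
  (cost (sortm le s) <= 2 * size s * trunc_log 2 (size s))%N.
Proof.
(* The factor 2 adds up the potential of the pushes and the cost of the final pops, each at most the
   number of elements times the logarithm. *)
suff cost_rec m ss s' : (size s' <= m)%N -> proper_stack 1 ss ->
    (cost (sortm_rec le ss s') + merge_levels 1 ss <=
     2 * (sumn (shape ss) + size s') *
       trunc_log 2 (sumn (shape ss) + size s'))%N.
  by have := cost_rec (size s) [::] s (leqnn _) isT; rewrite /= addn0.
have cost_pop s1 st : proper_stack 1 st ->
    (cost (popm le s1 st) + merge_levels 1 st <=
     2 * (sumn (shape st) + size s1) *
       trunc_log 2 (sumn (shape st) + size s1))%N.
  move=> st_ok; have := cost_popm s1 st; have := merge_levels_le 0 st.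
  have := proper_stack_size st_ok; rewrite !add0n.
  have [/size0nil->|_ /(_ isT) st_size] := posnP (size st).
    by rewrite /=; lia.
  have : (size st <= trunc_log 2 (sumn (shape st) + size s1))%N.
    by apply: trunc_log_max => //; lia.
  nia.
elim: m ss s' => [|m IHm] ss [|x1 [|x2 s']] //= lt_m ss_ok;
  try exact: cost_pop.
rewrite !cost_bind result_pushm; set s2 := if _ then _ else _.
have s2_size : size s2 = 2%N by rewrite /s2; case: ifP.
(* The pair [s2] enters at level 1 and raises the potential by 2, which also pays for the comparison
   that ordered it. *)
have := le_cost x1 x2; have := cost_pushm 1 s2 ss.
have /= := IHm (merge_sort_push leT s2 ss) s' _ (proper_stack_push _ ss_ok).
rewrite sumn_shape_push s2_size => /(_ _ isT).
have -> : (2 + sumn (shape ss) + size s' = sumn (shape ss) + (size s').+2)%N.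
  by lia.
move/(_ ltac:(lia)).
set c1 := cost _; set c2 := cost _; set c3 := cost _; lia.
Qed.

End MergeSort.

(** * Correctness and cost of the program for Rule 2 *)

Section Rule2Prog.
Context (R : realType) (n : nat) (I : instance R n).

Lemma result_check_all jks :
  result (check_all I jks) =
  all (fun jk => segment I * rate I jk.1 * (1 - reduction I jk.2)
                 <= allowable I jk.1) jks.
Proof. by elim: jks => //= jk jks IH; case: ifP => //= _. Qed.

(** One vehicle takes five arithmetic operations, one load of 1 and one comparison. *)
Lemma cost_check_all jks : (cost (check_all I jks) <= 7 * size jks)%N.
Proof. by elim: jks => //= jk jks IH; case: ifP => //= _; lia. Qed.

Lemma cost_rule2_prog :
  (cost (rule2_prog I) <= 2 * n * trunc_log 2 n + 7 * n)%N.
Proof.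
rewrite /rule2_prog !cost_bind /= addn0; apply: leq_add.
  rewrite -[X in (_ <= 2 * X * trunc_log 2 X)%N]size_enum_ord.
  by apply: cost_sortm => x y; exact: leqnn.
apply: leq_trans (cost_check_all _) _; rewrite leq_mul2l /= size_zip.
by rewrite size_enum_ord geq_minr.
Qed.

Lemma sorted_rates : exists p : 'S_n,
  (forall k l : 'I_n, (k <= l)%N -> rate I (p k) <= rate I (p l)) /\
  result (sortm (fun i j => leqm (rate I i) (rate I j)) (enum 'I_n)) =
    [seq p k | k <- enum 'I_n].
Proof.
pose leT (i j : 'I_n) := rate I i <= rate I j.
have /tuple_permP[p p_sort] : perm_eq (sort leT (enum 'I_n)) (ord_tuple n).
  by rewrite val_ord_tuple perm_sort.
have {}p_sort : sort leT (enum 'I_n) = [seq p k | k <- enum 'I_n].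
  by rewrite p_sort; apply: eq_map => k; rewrite tnth_ord_tuple.
exists p; split; last by rewrite result_sortm.
have leT_tr : transitive leT by move=> j i k; exact: le_trans.
have leT_refl : reflexive leT by move=> i; exact: lexx.
have : sorted leT (sort leT (enum 'I_n)).
  by apply: sort_sorted => i j; exact: le_total.
rewrite p_sort => p_sorted k l k_le_l.
have size_p : size [seq p i | i <- enum 'I_n] = n.
  by rewrite size_map size_enum_ord.
have nth_p (i : 'I_n) : nth (p k) [seq p i | i <- enum 'I_n] i = p i.
  by rewrite (nth_map i) ?size_enum_ord // nth_ord_enum.
have := sorted_leq_nth leT_tr leT_refl (p k) p_sorted k l.
by rewrite !inE size_p !nth_p => /(_ (ltn_ord k) (ltn_ord l) k_le_l).
Qed.

Lemma result_rule2_prog : exists s : 'S_n, rule2 I s /\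
  match result (rule2_prog I) with
  | Some js => js = by_position s /\ feasible I s
  | None => ~ feasible I s
  end.
Proof.
have [p [p_sorted p_sort]] := sorted_rates.
(* [p] maps positions to vehicles, whereas a solution maps vehicles to positions. *)
exists (p^-1)%g; split; first by exists p; split=> // k; rewrite permK.
rewrite /rule2_prog !result_bind p_sort -[X in zip _ X]map_id zip_map.
rewrite result_check_all all_map.
have feasP : reflect (feasible I p^-1) (all (preim (fun k => (p k, k))
    (fun jk => segment I * rate I jk.1 * (1 - reduction I jk.2)
               <= allowable I jk.1)) (enum 'I_n)).
  apply: (iffP allP) => [ok j|ok k _ /=].
    by have := ok ((p^-1)%g j) (mem_enum _ _); rewrite /= permKV.
  by have := ok (p k); rewrite /usage permK.
case: feasP => //= feas; split=> //.
by rewrite /by_position invgK.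
Qed.

End Rule2Prog.

(** * Asymptotic bound and conclusion *)

Lemma eqO_nlogn (R : realType) (a b : nat) :
  (fun n => (a * n * trunc_log 2 n + b * n)%N%:R : R^o)
    =O_\oo (fun n => n%:R * ln n%:R : R^o).
Proof.
have ln2_gt0 : 0 < ln (2 : R) by rewrite ln_gt0 // ltr1n.
(* The summand 1 keeps the constant positive when [a = b = 0]. *)
apply/eqO_exP; exists ((a + b)%:R / ln 2 + 1).
  by rewrite ltr_wpDl // divr_ge0 // ltW.
exists 2%N => // n /= n_ge2.
have n_gt0 : (0 < n)%N by lia.
have ln_ge : ln (2 : R) *+ trunc_log 2 n <= ln (n%:R : R).
  rewrite -lnXn // -natrX ler_ln ?posrE ?ltr0n ?expn_gt0 // ler_nat.
  exact: trunc_logP.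
(* From [n = 2] on the logarithm is at least 1 and absorbs the linear term. *)
have log_ge1 : (1 <= trunc_log 2 n)%N by apply: trunc_log_max.
rewrite !ger0_norm ?mulr_ge0 ?ln_ge0 ?ler1n //.
have nlog : ((a * n * trunc_log 2 n + b * n)%N%:R : R) <=
    (a + b)%:R * n%:R * (trunc_log 2 n)%:R.
  by rewrite -!natrM ler_nat; nia.
apply: le_trans nlog _; rewrite mulrDl mul1r -[leLHS]addr0 lerD //; last first.
  by rewrite mulr_ge0 ?ln_ge0 ?ler1n.
rewrite [leRHS](_ : _ = (a + b)%:R * n%:R * (ln n%:R / ln 2)); last by ring.
by rewrite ler_wpM2l ?mulr_ge0 // ler_pdivlMr // mulr_natl.
Qed.

Theorem proposition3 (R : realType) :
  (forall (n : nat) (I : instance R n) (A : R),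
     valid I -> (forall j, allowable I j = A) ->
     (forall s : 'S_n, rule2 I s ->
        (feasible I s -> optimal I s) /\ (~ feasible I s -> infeasible I)) /\
     match result (rule2_prog I) with
     | Some js => exists s : 'S_n,
         [/\ js = by_position s, rule2 I s & optimal I s]
     | None => infeasible I
     end) /\
  (exists T : nat -> nat,
     (forall (n : nat) (I : instance R n) (A : R),
        valid I -> (forall j, allowable I j = A) ->
        (cost (rule2_prog I) <= T n)%N) /\
     (fun n => (T n)%:R : R^o) =O_\oo (fun n => n%:R * ln n%:R : R^o)).
Proof.
split=> [n I A I_valid allowA|]; last first.
  exists (fun n => 2 * n * trunc_log 2 n + 7 * n)%N.
  split; last exact: eqO_nlogn.
  by move=> n I *; exact: cost_rule2_prog.
have rule2_infeasible s : rule2 I s -> ~ feasible I s -> infeasible I.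
  move=> s_rule2 s_infeas [t t_feas]; apply: s_infeas.
  exact: rule2_feasible t_feas.
split=> [s s_rule2|].
  split; [exact: rule2_optimal | exact: rule2_infeasible].
have [s [s_rule2]] := result_rule2_prog I.
case: (result _) => [js [-> s_feas]|]; last exact: rule2_infeasible.
by exists s; split=> //; exact: rule2_optimal.
Qed.
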